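(* Let $\mathcal{T}$ be a three-dimensional textile system with directed graphs $G,F_1,F_2,E$ and graph homomorphisms $p_1,q_1:G\to F_1$, $p_2,q_2:G\to F_2$, $g_1,h_1:F_1\to E$, $g_2,h_2:F_2\to E$. Suppose $q_1$ has $s$-path lifting. Then $\Lambda_{\mathcal{T}}$ is a $3$-graph if and only if the following conditions hold: (i) $g_1,g_2$ have unique $r$-path lifting; (ii) $h_1,h_2$ have unique $s$-path lifting; (iii) the two commutative squares of sets with maps $$q_1^0:G^0\to F_1^0,\ p_2^0:G^0\to F_2^0,\ g_1^0:F_1^0\to E^0,\ h_2^0:F_2^0\to E^0\qquad(g_1^0q_1^0=h_2^0p_2^0)$$ and $$p_1^0:G^0\to F_1^0,\ q_2^0:G^0\to F_2^0,\ h_1^0:F_1^0\to E^0,\ g_2^0:F_2^0\to E^0\qquad(h_1^0p_1^0=g_2^0q_2^0)$$ are pullback squares in the category of sets.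
   Context: A directed graph is written $E=(E^0,E^1,r_E,s_E)$: vertices, edges, range, source. A graph homomorphism $f=(f^0,f^1)$ consists of a vertex map and an edge map commuting with ranges and sources (superscripts are often dropped). $f:F\to E$ has $r$-path lifting (resp. $s$-path lifting) if whenever $v\in F^0$, $e\in E^1$ and $f^0(v)=r_E(e)$ (resp. $f^0(v)=s_E(e)$) there is $x\in F^1$ with $r_F(x)=v$ (resp. $s_F(x)=v$) and $f^1(x)=e$; the lifting is unique if $x$ is always unique. A three-dimensional textile system consists of directed graphs $G,F_1,F_2,E$ and graph homomorphisms as in the claim such that ($\mathcal C$) $g_1p_1=g_2p_2$, $h_1q_1=h_2q_2$, $g_1q_1=h_2p_2$, $h_1p_1=g_2q_2$; and ($\mathcal I$) the following maps are injective: $s_G\times r_G\times p_1^1\times q_1^1\times p_2^1\times q_2^1$ on $G^1$; $p_1^0\times q_1^0\times p_2^0\times q_2^0$ on $G^0$; $s_{F_1}\times r_{F_1}\times g_1^1\times h_1^1$ on $F_1^1$; $s_{F_2}\times r_{F_2}\times g_2^1\times h_2^1$ on $F_2^1$ (each map sends an element to the tuple of its images). A $k$-graph is a small category $\Lambda$ with a functor $d:\Lambda\to\mathbb{N}^k$ ($\mathbb{N}$ includes $0$) satisfying unique factorization: if $d(\lambda)=\mathbf n+\mathbf m$ there are unique $\alpha,\beta$ with $d(\alpha)=\mathbf n$, $d(\beta)=\mathbf m$, $\lambda=\alpha\beta$. Construction of $\Lambda_{\mathcal T}$. Let $G_{\mathcal T}$ be the directed graph with vertex set $E^0$ and edge set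 the disjoint union $F_1^0\sqcup F_2^0\sqcup E^1$, where $x\in F_i^0$ has source $g_i(x)$ and range $h_i(x)$ ($i=1,2$) and $x\in E^1$ has source $s_E(x)$ and range $r_E(x)$. Give edges in $F_1^0,F_2^0,E^1$ the colors $\mathbf e_2,\mathbf e_1,\mathbf e_3\in\mathbb{N}^3$ respectively, and let $d$ of a path be the sum of its colors ($d=0$ on vertices). Paths $x_1x_2\cdots x_m$ satisfy $r(x_i)=s(x_{i+1})$, and $G_{\mathcal T}^*$ is the path category (composition is concatenation; when viewed as a $k$-graph, the codomain of a path is its initial vertex and the domain its terminal vertex). Define relations on bicolored paths of length 2: - $vw\,R^{12}\,w'v'$ ($v,v'\in F_2^0$, $w,w'\in F_1^0$) if there is $x\in G^0$ with $p_2^0(x)=v$, $q_2^0(x)=v'$, $p_1^0(x)=w'$, $q_1^0(x)=w$; - $we\,R^{23}\,e'w'$ ($w,w'\in F_1^0$, $e,e'\in E^1$) if there is $x\in F_1^1$ with $s_{F_1}(x)=w$, $r_{F_1}(x)=w'$, $g_1(x)=e'$, $h_1(x)=e$; - $ve\,R^{13}\,e'v'$ ($v,v'\in F_2^0$, $e,e'\in E^1$) if there is $x\in F_2^1$ with $s_{F_2}(x)=v$, $r_{F_2}(x)=v'$, $g_2(x)=e'$, $h_2(x)=e$. Let $\mathcal{R}$ be the smallest congruence on $G_{\mathcal T}^*$ containing $R^{12}\cup R^{23}\cup R^{13}$ (and the identity relation on edges), and $\Lambda_{\mathcal T}:=G_{\mathcal T}^*/\mathcal{R}$, with degree functor $d:\Lambda_{\mathcal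 T}\to\mathbb{N}^3$ induced by $d$. ''$\Lambda_{\mathcal T}$ is a $3$-graph'' means $(\Lambda_{\mathcal T},d)$ is a $3$-graph. *)

(* Defs.v *)
From mathcomp Require Import all_boot ssralg nmodule.
From mathcomp Require Import boolp.
Set Implicit Arguments.
Unset Strict Implicit.
Unset Printing Implicit Defensive.
Import GRing.Theory.
Local Open Scope ring_scope.
Local Open Scope quotient_scope.

Record digraph := Digraph {
  vtx : Type;
  edge : Type;
  rng : edge -> vtx;
  src : edge -> vtx }.
Arguments rng {_} _.
Arguments src {_} _.

Record ghom (F E : digraph) := GHom {
  hom0 : vtx F -> vtx E;
  hom1 : edge F -> edge E;
  hom_rng : forall x, hom0 (rng x) = rng (hom1 x);
  hom_src : forall x, hom0 (src x) = src (hom1 x) }.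

Definition gcomp (G F E : digraph) (g : ghom F E) (f : ghom G F) : ghom G E.
Proof.
exists (hom0 g \o hom0 f) (hom1 g \o hom1 f) => x /=.
- by rewrite !hom_rng.
- by rewrite !hom_src.
Defined.

Definition ghom_eq (F E : digraph) (f g : ghom F E) : Prop :=
  hom0 f =1 hom0 g /\ hom1 f =1 hom1 g.

Definition s_path_lifting (F E : digraph) (f : ghom F E) : Prop :=
  forall (v : vtx F) (e : edge E), hom0 f v = src e ->
    exists x : edge F, src x = v /\ hom1 f x = e.

Definition unique_r_path_lifting (F E : digraph) (f : ghom F E) : Prop :=
  forall (v : vtx F) (e : edge E), hom0 f v = rng e ->
    exists! x : edge F, rng x = v /\ hom1 f x = e.

Definition unique_s_path_lifting (F E : digraph) (f : ghom F E) : Prop :=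
  forall (v : vtx F) (e : edge E), hom0 f v = src e ->
    exists! x : edge F, src x = v /\ hom1 f x = e.

Definition is_pullback (P A B C : Type)
    (a : P -> A) (b : P -> B) (f : A -> C) (g : B -> C) : Prop :=
  f \o a = g \o b /\
  forall (X : Type) (u : X -> A) (v : X -> B), f \o u = g \o v ->
    exists! w : X -> P, a \o w = u /\ b \o w = v.

Record category := Category {
  ob : Type;
  mor : ob -> ob -> Type; (* [mor a b]: domain [a], codomain [b] *)
  idm : forall a, mor a a;
  comp : forall a b c, mor b c -> mor a b -> mor a c;
  compA : forall a b c d (h : mor c d) (g : mor b c) (f : mor a b),
    comp h (comp g f) = comp (comp h g) f;
  comp1m : forall a b (f : mor a b), comp (idm b) f = f;
  compm1 : forall a b (f : mor a b), comp f (idm a) = f }.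
Arguments mor {_} _ _.
Arguments idm {_} _.
Arguments comp {_ _ _ _} _ _.

Definition morrel (C : category) := forall a b : ob C, mor a b -> mor a b -> Prop.

Record congruence (C : category) (R : morrel C) : Prop := Congruence {
  cong_refl : forall a b (f : mor a b), R a b f f;
  cong_sym : forall a b (f g : mor a b), R a b f g -> R a b g f;
  cong_trans : forall a b (f g h : mor a b), R a b f g -> R a b g h -> R a b f h;
  cong_comp : forall a b c (g g' : mor b c) (f f' : mor a b),
    R b c g g' -> R a b f f' -> R a c (comp g f) (comp g' f') }.

Definition smallest_congruence (C : category) (R : morrel C) : morrel C :=
  fun a b f g => forall S : morrel C, congruence S ->
    (forall a' b' (f' g' : mor a' b'), R a' b' f' g' -> S a' b' f' g') ->
    S a b f g.

Lemma smallest_congruence_cong (C : category) (R : morrel C) :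
  congruence (smallest_congruence R).
Proof.
split=> [a b f|a b f g fg|a b f g h fg gh|a b c g g' f f' gg' ff'] S cS RS.
- exact: (cong_refl cS).
- exact: (cong_sym cS (fg _ cS RS)).
- exact: (cong_trans cS (fg _ cS RS) (gh _ cS RS)).
- exact: (cong_comp cS (gg' _ cS RS) (ff' _ cS RS)).
Qed.

Section Quotient.
Context (C : category) (R : morrel C) (cR : congruence R).

Definition cong_rel (a b : ob C) : rel {classic (mor a b)} :=
  fun f g => `[< R f g >].

Lemma cong_rel_refl a b : reflexive (@cong_rel a b).
Proof. by move=> f; apply/asboolP/(cong_refl cR). Qed.

Lemma cong_rel_sym a b : symmetric (@cong_rel a b).
Proof. by move=> f g; apply/asboolP/asboolP; apply: (cong_sym cR). Qed.

Lemma cong_rel_trans a b : transitive (@cong_rel a b).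
Proof.
move=> g f h /asboolP fg /asboolP gh; apply/asboolP.
exact: (cong_trans cR fg gh).
Qed.

Definition cong_equiv a b : equiv_rel {classic (mor a b)} :=
  EquivRel (@cong_rel a b) (@cong_rel_refl a b) (@cong_rel_sym a b)
    (@cong_rel_trans a b).

Definition qmor (a b : ob C) : Type := {eq_quot (cong_equiv a b)}.

Definition qclass (a b : ob C) (f : mor a b) : qmor a b :=
  \pi_{eq_quot (cong_equiv a b)} f.

Definition qrepr (a b : ob C) (x : qmor a b) : mor a b :=
  repr (x : {eq_quot (cong_equiv a b)}).

Lemma qreprK a b (x : qmor a b) : qclass (qrepr x) = x.
Proof. exact: reprK. Qed.

Lemma qclassP a b (f g : mor a b) : qclass f = qclass g <-> R f g.
Proof.
split=> [/eqmodP/asboolP //|Rfg].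
by apply/eqmodP/asboolP.
Qed.

Lemma qrepr_class a b (f : mor a b) : R (qrepr (qclass f)) f.
Proof. by apply/qclassP; rewrite qreprK. Qed.

Definition qcomp (a b c : ob C) (y : qmor b c) (x : qmor a b) : qmor a c :=
  qclass (comp (qrepr y) (qrepr x)).

Lemma qcompE a b c (g : mor b c) (f : mor a b) :
  qcomp (qclass g) (qclass f) = qclass (comp g f).
Proof. by apply/qclassP; apply: (cong_comp cR); apply: qrepr_class. Qed.

Lemma qcompA a b c d (z : qmor c d) (y : qmor b c) (x : qmor a b) :
  qcomp z (qcomp y x) = qcomp (qcomp z y) x.
Proof. by rewrite -(qreprK x) -(qreprK y) -(qreprK z) !qcompE compA. Qed.

Lemma qcomp1m a b (x : qmor a b) : qcomp (qclass (idm b)) x = x.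
Proof. by rewrite -(qreprK x) qcompE comp1m. Qed.

Lemma qcompm1 a b (x : qmor a b) : qcomp x (qclass (idm a)) = x.
Proof. by rewrite -(qreprK x) qcompE compm1. Qed.

Definition quotient_category : category :=
  @Category (ob C) qmor (fun a => qclass (idm a)) qcomp qcompA qcomp1m qcompm1.

End Quotient.

(* A functor from C to the one-object category N^k. *)
Record degree_functor (k : nat) (C : category) := DegreeFunctor {
  deg : forall a b : ob C, mor a b -> {ffun 'I_k -> nat};
  deg_idm : forall a, deg (idm a) = 0;
  deg_comp : forall a b c (g : mor b c) (f : mor a b),
    deg (comp g f) = deg g + deg f }.
Arguments deg {_ _} _ {_ _} _.

Definition is_kgraph (k : nat) (C : category) (d : degree_functor k C) : Prop :=
  forall (a c : ob C) (l : @mor C a c) (n m : {ffun 'I_k -> nat}),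
    deg d l = n + m ->
    exists! f : {b : ob C & (@mor C b c * @mor C a b)%type},
      [/\ deg d (projT2 f).1 = n,
          deg d (projT2 f).2 = m
        & l = comp (projT2 f).1 (projT2 f).2].

(* A degree functor constant on the classes of R induces one on C/R. *)
Definition quotient_degree (k : nat) (C : category) (R : morrel C)
    (cR : congruence R) (d : degree_functor k C)
    (dR : forall a b (f g : mor a b), R a b f g -> deg d f = deg d g) :
  degree_functor k (quotient_category cR).
Proof.
apply: (@DegreeFunctor k (quotient_category cR)
  (fun a b (x : qmor cR a b) => deg d (qrepr x))) => [a|a b c g f].
- by rewrite (dR _ _ _ _ (qrepr_class cR _)) deg_idm.
- by rewrite (dR _ _ _ _ (qrepr_class cR _)) deg_comp.
Defined.

(* [s] is a path x_1 ... x_m with r(x_i) = s(x_{i+1}), from [v] to [w]. *)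
Fixpoint is_path (G : digraph) (v : vtx G) (s : seq (edge G)) (w : vtx G) : Prop :=
  if s is x :: s' then src x = v /\ is_path (rng x) s' w else v = w.

(* The codomain of a path is its initial vertex, the domain its terminal one. *)
Definition gpath (G : digraph) (a b : vtx G) : Type :=
  {s : seq (edge G) | is_path b s a}.

Lemma gpath_inj (G : digraph) (a b : vtx G) (p q : gpath a b) :
  sval p = sval q -> p = q.
Proof. by case: p q => [s ps] [t pt] /= st; exact: eq_exist. Qed.

Lemma is_path_cat (G : digraph) (u v w : vtx G) (s t : seq (edge G)) :
  is_path u s v -> is_path v t w -> is_path u (s ++ t) w.
Proof.
by elim: s u => [u -> //|x s IHs u [xu ps] pt]; split; last exact: IHs.
Qed.

Definition gpath_id (G : digraph) (a : vtx G) : gpath a a :=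
  exist _ [::] (erefl a).

Definition gpath_comp (G : digraph) (a b c : vtx G)
    (q : gpath b c) (p : gpath a b) : gpath a c :=
  exist _ (sval q ++ sval p) (is_path_cat (svalP q) (svalP p)).

Definition path_category (G : digraph) : category.
Proof.
apply: (@Category (vtx G) (@gpath G) (@gpath_id G) (@gpath_comp G)).
- by move=> a b c d h g f; apply: gpath_inj; rewrite /= catA.
- by move=> a b f; apply: gpath_inj.
- by move=> a b f; apply: gpath_inj; rewrite /= cats0.
Defined.

Definition path_degree (k : nat) (G : digraph)
    (color : edge G -> {ffun 'I_k -> nat}) : degree_functor k (path_category G).
Proof.
apply: (@DegreeFunctor k (path_category G)
  (fun a b (p : gpath a b) => \sum_(x <- sval p) color x)) => [a|a b c g f].
- by rewrite big_nil.
- by rewrite /= big_cat.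
Defined.

Record textile3 := Textile3 {
  G : digraph; F1 : digraph; F2 : digraph; E : digraph;
  p1 : ghom G F1; q1 : ghom G F1;
  p2 : ghom G F2; q2 : ghom G F2;
  g1 : ghom F1 E; h1 : ghom F1 E;
  g2 : ghom F2 E; h2 : ghom F2 E;
  comm_gp : ghom_eq (gcomp g1 p1) (gcomp g2 p2);
  comm_hq : ghom_eq (gcomp h1 q1) (gcomp h2 q2);
  comm_gq : ghom_eq (gcomp g1 q1) (gcomp h2 p2);
  comm_hp : ghom_eq (gcomp h1 p1) (gcomp g2 q2);
  inj_G1 : injective (fun x : edge G =>
    (src x, rng x, hom1 p1 x, hom1 q1 x, hom1 p2 x, hom1 q2 x));
  inj_G0 : injective (fun x : vtx G =>
    (hom0 p1 x, hom0 q1 x, hom0 p2 x, hom0 q2 x));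
  inj_F1 : injective (fun x : edge F1 => (src x, rng x, hom1 g1 x, hom1 h1 x));
  inj_F2 : injective (fun x : edge F2 => (src x, rng x, hom1 g2 x, hom1 h2 x)) }.
Arguments p1 {_}. Arguments q1 {_}. Arguments p2 {_}. Arguments q2 {_}.
Arguments g1 {_}. Arguments h1 {_}. Arguments g2 {_}. Arguments h2 {_}.

Inductive tedge (T : textile3) : Type :=
  | EF1 of vtx (F1 T)
  | EF2 of vtx (F2 T)
  | EE of edge (E T).
Arguments EF1 {T} _.
Arguments EF2 {T} _.
Arguments EE {T} _.

Definition tsrc (T : textile3) (x : tedge T) : vtx (E T) :=
  match x with EF1 w => hom0 g1 w | EF2 v => hom0 g2 v | EE e => src e end.

Definition trng (T : textile3) (x : tedge T) : vtx (E T) :=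
  match x with EF1 w => hom0 h1 w | EF2 v => hom0 h2 v | EE e => rng e end.

Definition tgraph (T : textile3) : digraph :=
  @Digraph (vtx (E T)) (tedge T) (@trng T) (@tsrc T).

Definition basis_vec (k : nat) (i : 'I_k) : {ffun 'I_k -> nat} :=
  [ffun j => (j == i : nat)].

(* The basis vectors e_1, e_2, e_3 have the indices 0, 1, 2 of 'I_3. *)
Definition tcolor (T : textile3) (x : edge (tgraph T)) : {ffun 'I_3 -> nat} :=
  match x with
  | EF1 _ => basis_vec (Ordinal (isT : 1 < 3)%N)
  | EF2 _ => basis_vec (Ordinal (isT : 0 < 3)%N)
  | EE _ => basis_vec (Ordinal (isT : 2 < 3)%N)
  end.

Definition R12 (T : textile3) (s t : seq (tedge T)) : Prop :=
  exists (v v' : vtx (F2 T)) (w w' : vtx (F1 T)),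
    [/\ s = [:: EF2 v; EF1 w], t = [:: EF1 w'; EF2 v']
      & exists x : vtx (G T),
          [/\ hom0 p2 x = v, hom0 q2 x = v', hom0 p1 x = w' & hom0 q1 x = w]].

Definition R23 (T : textile3) (s t : seq (tedge T)) : Prop :=
  exists (w w' : vtx (F1 T)) (e e' : edge (E T)),
    [/\ s = [:: EF1 w; EE e], t = [:: EE e'; EF1 w']
      & exists x : edge (F1 T),
          [/\ src x = w, rng x = w', hom1 g1 x = e' & hom1 h1 x = e]].

Definition R13 (T : textile3) (s t : seq (tedge T)) : Prop :=
  exists (v v' : vtx (F2 T)) (e e' : edge (E T)),
    [/\ s = [:: EF2 v; EE e], t = [:: EE e'; EF2 v']
      & exists x : edge (F2 T),
          [/\ src x = v, rng x = v', hom1 g2 x = e' & hom1 h2 x = e]].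

Definition Redge (T : textile3) (s t : seq (tedge T)) : Prop :=
  exists x : tedge T, s = [:: x] /\ t = [:: x].

Definition Rgen (T : textile3) : morrel (path_category (tgraph T)) :=
  fun a b (p q : @gpath (tgraph T) a b) =>
    [\/ R12 (sval p) (sval q), R23 (sval p) (sval q),
        R13 (sval p) (sval q) | Redge (sval p) (sval q)].

(* Both sides of R12, R23 and R13 have the same end points, so restricting
   these relations to parallel paths in Rgen loses nothing. *)
Lemma R_parallel (T : textile3) (s t : seq (tedge T)) (a b : vtx (E T)) :
  [\/ R12 s t, R23 s t | R13 s t] ->
  @is_path (tgraph T) b s a <-> @is_path (tgraph T) b t a.
Proof.
have gp := (comm_gp T).1; have hq := (comm_hq T).1.
have gq := (comm_gq T).1; have hp := (comm_hp T).1.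
rewrite /= in gp hq gq hp.
case=> [] [v [v' [w [w' [-> -> [x [<- <- <- <-]]]]]]] /=.
- have [{}gp {}hq] := (gp x, hq x).
  have [{}gq {}hp] := (gq x, hp x); rewrite /= in gp hq gq hp.
  by rewrite gp hq gq hp; split=> [[<- [_ <-]]|[<- [_ <-]]].
- by rewrite -!hom_src -!hom_rng; split=> [[<- [_ <-]]|[<- [_ <-]]].
- by rewrite -!hom_src -!hom_rng; split=> [[<- [_ <-]]|[<- [_ <-]]].
Qed.

Definition tcongr (T : textile3) : morrel (path_category (tgraph T)) :=
  smallest_congruence (@Rgen T).

Definition Lambda (T : textile3) : category :=
  quotient_category (smallest_congruence_cong (@Rgen T)).

Lemma tcongr_degree (T : textile3) (a b : ob (path_category (tgraph T)))
    (p q : mor a b) :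
  tcongr p q -> deg (path_degree (@tcolor T)) p = deg (path_degree (@tcolor T)) q.
Proof.
move=> /(_ (fun a b p q => deg (path_degree (@tcolor T)) p
                         = deg (path_degree (@tcolor T)) q)); apply.
- split=> [//|//|a' b' f g h -> //|a' b' c g g' f f' gg' ff'].
  by rewrite !deg_comp gg' ff'.
- move=> a' b' f g; case.
  + by case=> v [v' [w [w' [/= -> -> _]]]]; rewrite !big_cons !big_nil !addr0 addrC.
  + by case=> v [v' [w [w' [/= -> -> _]]]]; rewrite !big_cons !big_nil !addr0 addrC.
  + by case=> v [v' [w [w' [/= -> -> _]]]]; rewrite !big_cons !big_nil !addr0 addrC.
  + by case=> x [/= -> ->].
Qed.

Definition Lambda_degree (T : textile3) : degree_functor 3 (Lambda T) :=
  quotient_degree (smallest_congruence_cong (@Rgen T)) (@tcongr_degree T).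

(* Main.v *)
(** Unique factorization of paths of length two says exactly that each bicolored
composable pair of edges is one side of exactly one square; by the injectivity
condition this amounts to (i)-(iii). Conversely, given such squares, a path can
be rearranged into any order of its colors, and what remains is to see that two
congruent paths with the same color word are equal. Insertion sort, which moves
an edge past another by exchanging the two sides of a square, is injective on
paths with a fixed color word, and it is constant on congruence classes as soon
as the two ways of reversing a tricolored path of length three agree. The
latter holds since [s]-path lifting of [q1] extends each such path to a cube,
that is, to an edge of [G]. *)
Require Import Defs.
From mathcomp Require Import all_boot.
From mathcomp Require Import ssralg boolp.
Set Implicit Arguments.
Unset Strict Implicit.
Unset Printing Implicit Defensive.
Import GRing.Theory.

(** * Congruence of words generated by squares in an edge-colored graph *)

Section ColoredSquares.
Context (D : digraph) (k : nat) (col : edge D -> 'I_k).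
Context (S : edge D * edge D -> edge D * edge D -> Prop).
Implicit Types (x y z : edge D) (s t r : seq (edge D)) (u v w : vtx D).

(** A square has two sides, the paths [xy] and [y'x'], with [x'] opposite to [x] and [y'] opposite
    to [y]. By symmetry [sq_col] also gives [x'] the color of [x]. *)
Record square_system : Prop := SquareSystem {
  sq_sym : forall p q, S p q -> S q p;
  sq_comp : forall x y y' x', S (x, y) (y', x') -> rng x = src y;
  sq_src : forall x y y' x', S (x, y) (y', x') -> src y' = src x;
  sq_rng : forall x y y' x', S (x, y) (y', x') -> rng x' = rng y;
  sq_col : forall x y y' x', S (x, y) (y', x') -> col y' = col y;
  sq_neq : forall x y y' x', S (x, y) (y', x') -> col x != col y }.

Definition complete_squares : Prop :=
  forall x y, rng x = src y -> col x != col y -> exists! q, S (x, y) q.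

(* The two reversals [xyz -> y1 x1 z -> y1 z1 x3 -> z3 y3 x3] and
   [xyz -> x z2 y2 -> z3 x2 y2 -> z3 y3 x3] have the same result. *)
Definition cube_condition : Prop :=
  forall x y z, rng x = src y -> rng y = src z ->
    (col x < col y)%N -> (col y < col z)%N ->
    exists x1 x2 x3 y1 y2 y3 z1 z2 z3,
      [/\ S (x, y) (y1, x1), S (x1, z) (z1, x3) & S (y1, z1) (z3, y3)] /\
      [/\ S (y, z) (z2, y2), S (x, z2) (z3, x2) & S (x2, y2) (y3, x3)].

(** Words carry no end points here, which keeps dependent types out of the inductions. In a square
    system, a word congruent to a path is a path with the same end points ([sqcong_path]). *)
Inductive sqcong : seq (edge D) -> seq (edge D) -> Prop :=
| sqcong_refl s : sqcong s s
| sqcong_sym s t : sqcong s t -> sqcong t s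
| sqcong_trans t s r : sqcong s t -> sqcong t r -> sqcong s r
| sqcong_cat s s' t t' : sqcong s s' -> sqcong t t' -> sqcong (s ++ t) (s' ++ t')
| sqcong_sq x y y' x' : S (x, y) (y', x') -> sqcong [:: x; y] [:: y'; x'].

Lemma is_path_split u w s t :
  is_path u (s ++ t) w -> exists2 v, is_path u s v & is_path v t w.
Proof.
elim: s u => [|x s IHs] u /=; first by exists u.
by case=> xu /IHs[v sv tv]; exists v.
Qed.

Lemma is_path_end u v w s : is_path u s v -> is_path u s w -> v = w.
Proof.
elim: s u => [u /= <- <- //|x s IHs u [_ sv] [_ sw]].
exact: (IHs _ sv sw).
Qed.

Definition to_gpath u w s (sp : is_path w s u) : gpath u w := exist _ s sp.

Hypothesis sqS : square_system.

Lemma sq_col2 x y y' x' : S (x, y) (y', x') -> col x' = col x.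
Proof. by move=> /(sq_sym sqS) /(sq_col sqS) ->. Qed.

Lemma sq_comp2 x y y' x' : S (x, y) (y', x') -> rng y' = src x'.
Proof. by move=> /(sq_sym sqS) /(sq_comp sqS). Qed.

Lemma sqcong_path s t : sqcong s t -> forall u w, is_path u s w <-> is_path u t w.
Proof.
elim=> {s t} [//|s t _ IH u w|t s r _ IH1 _ IH2 u w|s s' t t' _ IH1 _ IH2 u w|
  x y y' x' xy u w].
- by rewrite IH.
- by rewrite IH1.
- split=> /is_path_split[v]; [rewrite IH1 IH2|rewrite -IH1 -IH2];
  exact: is_path_cat.
- have e1 := sq_comp sqS xy; have e2 := sq_comp2 xy.
  have e3 := sq_src sqS xy; have e4 := sq_rng sqS xy.
  by rewrite /= e1 e2 e3 e4; split=> [] [? [_ ?]].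
Qed.

Lemma sqcong_perm s t : sqcong s t -> perm_eq (map col s) (map col t).
Proof.
elim=> {s t} [//|s t _|t s r _ IH1 _ IH2|s s' t t' _ IH1 _ IH2|x y y' x' xy].
- by rewrite perm_sym.
- exact: (perm_trans IH1 IH2).
- by rewrite !map_cat perm_cat.
- by rewrite /= (sq_col sqS xy) (sq_col2 xy) (perm_catC [:: _] [:: _]).
Qed.

Lemma sqcong_size s t : sqcong s t -> size s = size t.
Proof. by move=> /sqcong_perm /perm_size; rewrite !size_map. Qed.

Definition has_square s : Prop := exists x y q, s = [:: x; y] /\ S (x, y) q.

(* Congruent words of length two are joined by a zigzag of squares. Only the
   existence of the first and the last square is recorded. *)
Lemma sqcong_short s t : sqcong s t -> (size s <= 2)%N ->
  s = t \/ has_square s /\ has_square t.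
Proof.
elim=> {s t} [s _|s t st IH|t s r st IH1 _ IH2|s s' t t' ss IH1 tt IH2|
  x y y' x' xy _].
- by left.
- by rewrite -(sqcong_size st) => /IH[->|[]]; [left|right].
- move=> s2; have := s2; rewrite (sqcong_size st) => /IH2 H2.
  by case: (IH1 s2) H2 => [->|[? ?]] [<-|[? ?]]; (try by right); left.
- rewrite size_cat => s2.
  (* A factor containing a square already has length two, so the other factor is empty. *)
  have nilcat a b c d : (size a + size b <= 2)%N -> size b = size d ->
      has_square a /\ has_square c ->
      has_square (a ++ b) /\ has_square (c ++ d).
    move=> le2 bd [[x [y [q [ea ha]]]] [x' [y' [q' [ec hc]]]]].
    have b0 : b = [::] by apply: size0nil; move: le2; rewrite ea; case: (size b).
    have d0 : d = [::] by apply: size0nil; rewrite -bd b0.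
    by rewrite b0 d0 !cats0; split; [exists x, y, q|exists x', y', q'].
  have catnil a b c d : (size b + size a <= 2)%N -> size b = size d ->
      has_square a /\ has_square c ->
      has_square (b ++ a) /\ has_square (d ++ c).
    move=> le2 bd [[x [y [q [ea ha]]]] [x' [y' [q' [ec hc]]]]].
    have b0 : b = [::] by apply: size0nil; move: le2; rewrite ea addnC; case: (size b).
    have d0 : d = [::] by apply: size0nil; rewrite -bd b0.
    by rewrite b0 d0; split; [exists x, y, q|exists x', y', q'].
  case: (IH1 (leq_trans (leq_addr _ _) s2)) => [->|hs]; last first.
    by right; apply: nilcat hs; rewrite // (sqcong_size tt).
  case: (IH2 (leq_trans (leq_addl _ _) s2)) => [->|hs]; first by left.
  by right; apply: catnil hs; rewrite // -(sqcong_size ss).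
- right; split; first by exists x, y, (y', x').
  by exists y', x', (x, y); split=> //; apply: (sq_sym sqS).
Qed.

Lemma sqcong_edge x s : sqcong [:: x] s -> s = [:: x].
Proof. by case/sqcong_short=> // -[[? [? [? []]]]]. Qed.

(** * Rearranging colors by complete squares *)

Section Completeness.
Hypothesis S_complete : complete_squares.

(** Completeness provides a square on an edge of another color followed by an edge of color [i], so
    the latter can be moved in front; induction brings it to the head. *)
Lemma sqcong_front i u w s : is_path u s w -> i \in map col s ->
  exists y t, col y = i /\ sqcong s (y :: t).
Proof.
elim: s u => [//|x s IHs] u /= [_ sw]; rewrite inE.
have [-> _|ix] := eqVneq i (col x); first by exists x, s; split=> //; apply: sqcong_refl.
case/(IHs _ sw)=> y [t [yi st]].
have [xy _] := (sqcong_path st _ _).1 sw.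
case: (S_complete (esym xy)); first by rewrite yi eq_sym.
case=> y' x' [sq _]; exists y', (x' :: t); split.
  by rewrite (sq_col sqS sq).
apply: (sqcong_trans (t := x :: y :: t)).
  exact: (sqcong_cat (sqcong_refl [:: x]) st).
exact: (sqcong_cat (sqcong_sq sq) (sqcong_refl t)).
Qed.

Lemma sqcong_rearrange (c : seq 'I_k) u w s : is_path u s w ->
  perm_eq (map col s) c -> exists2 t, sqcong s t & map col t = c.
Proof.
elim: c u s => [|i c IHc] u s sw.
  move=> /perm_size /size0nil s0; exists s => //; exact: sqcong_refl.
move=> sc; have /(sqcong_front sw)[y [t [yi st]]] : i \in map col s.
  by rewrite (perm_mem sc) mem_head.
have [_ tw] := (sqcong_path st _ _).1 sw.
have := perm_trans _ sc; move/(_ (map col (y :: t))).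
rewrite perm_sym => /(_ (sqcong_perm st)); rewrite /= yi perm_cons.
case/(IHc _ _ tw) => t' tt' t'c; exists (y :: t') => /=; last by rewrite yi t'c.
exact: (sqcong_trans st (sqcong_cat (sqcong_refl [:: y]) tt')).
Qed.

(** * Insertion sort of paths by color *)

Section Sorting.
Context (sigma : edge D * edge D -> edge D * edge D).
Hypothesis sigmaP : forall p q, S p q -> sigma p = q.

(* Sorts by decreasing color; [sigma] exchanges the two sides of a square. *)
Fixpoint insert x s : seq (edge D) :=
  if s is y :: s' then
    if (col x < col y)%N
    then (sigma (x, y)).1 :: insert (sigma (x, y)).2 s'
    else x :: s
  else [:: x].

Lemma sigmaS x y : rng x = src y -> (col x < col y)%N ->
  exists y' x', sigma (x, y) = (y', x') /\ S (x, y) (y', x').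
Proof.
move=> xy lt; case: (S_complete xy); first by rewrite -val_eqE neq_ltn lt.
by case=> y' x' [sq _]; exists y', x'; rewrite (sigmaP sq).
Qed.

Lemma insert_path x s w :
  is_path (rng x) s w -> is_path (src x) (insert x s) w.
Proof.
elim: s x => [|y s IHs] x /=; first by [].
case=> xy sw; case: ifP => // /(sigmaS (esym xy))[y' [x' [-> sq]]] /=.
rewrite (sq_src sqS sq) (sq_comp2 sq); split=> //.
by apply: IHs; rewrite (sq_rng sqS sq).
Qed.

Lemma sort_path u v w s r :
  is_path u s v -> is_path v r w -> is_path u (foldr insert r s) w.
Proof.
elim: s u => [u <- //|x s IHs u [<- sv] rw] /=.
exact/insert_path/IHs.
Qed.

(** When both edges pass the head [z] of the tail, the two sides of the equation perform the two
    reversals of [xyz], which the cube condition identifies; induction treats the rest of the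
    tail. *)
Lemma insert_swap (cube : cube_condition) x y s w : rng x = src y ->
  (col x < col y)%N -> is_path (rng y) s w ->
  insert x (insert y s) = insert (sigma (x, y)).1 (insert (sigma (x, y)).2 s).
Proof.
elim: s x y => [|z s IHs] x y xy ltxy.
  move=> _; have [y' [x' [e sq]]] := sigmaS xy ltxy.
  by rewrite /= ltxy e /= (sq_col sqS sq) (sq_col2 sq) ltnNge (ltnW ltxy).
case=> zy sw; case: (ltnP (col y) (col z)) => [ltyz|lezy].
  have [x1 [x2 [x3 [y1 [y2 [y3 [z1 [z2 [z3 [[A1 A2 A3] [B1 B2 B3]]]]]]]]]]] :=
    cube x y z xy (esym zy) ltxy ltyz.
  have ltxz := ltn_trans ltxy ltyz.
  rewrite /= ltyz (sigmaP A1) (sigmaP B1) /= (sq_col2 A1) ltxz.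
  rewrite (sigmaP A2) /= (sq_col sqS B1) ltxz (sigmaP B2) /=.
  rewrite (sq_col sqS A1) (sq_col sqS A2) ltyz (sigmaP A3) /=.
  (* Both sides now begin with [z3], and their tails differ by the exchange of [x2] and [y2]. *)
  rewrite (IHs x2 y2) ?(sigmaP B3) //.
  - exact: (sq_comp sqS B3).
  - by rewrite (sq_col2 B2) (sq_col2 B1).
  - by rewrite (sq_rng sqS B1).
(* Here [y] stops before [z]. On the right, the head of [insert x' (z :: s)] has the color of [z] or
   of [x], neither above that of [y], so [y'] stays in front as well. *)
have [y' [x' [e sq]]] := sigmaS xy ltxy.
have -> : insert y (z :: s) = y :: z :: s by rewrite /= ltnNge lezy.
rewrite [in LHS]/= ltxy e [(_, _).1]/= [(_, _).2]/=.
rewrite -[RHS]/(insert y' (insert x' (z :: s))) /= (sq_col2 sq).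
case: ifP => [ltxz|_] /=; last first.
  by rewrite (sq_col sqS sq) (sq_col2 sq) ltnNge (ltnW ltxy).
have x'z : rng x' = src z by rewrite (sq_rng sqS sq).
have [|z' [x'' [-> sq']]] := sigmaS x'z; first by rewrite (sq_col2 sq).
by rewrite /= (sq_col sqS sq') (sq_col sqS sq) ltnNge lezy.
Qed.

(** The tail [r] is arbitrary because sorting [s ++ t] inserts the edges of [s] into the result of
    sorting [t], so the concatenation case needs the claim for other tails. *)
Lemma sort_sqcong (cube : cube_condition) s t : sqcong s t ->
  forall u v w r, is_path u s v -> is_path v r w ->
  foldr insert r s = foldr insert r t.
Proof.
elim=> {s t} [//|s t st IH|t s r st IH1 _ IH2|s s' t t' ss IH1 tt IH2|
  x y y' x' sq] u v w r0.
- by rewrite -(sqcong_path st) => p q; rewrite (IH u v w).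
- move=> p q; rewrite (IH1 u v w) // (IH2 u v w) //.
  by rewrite -(sqcong_path st).
- case/is_path_split=> u' p q rp; rewrite !foldr_cat.
  rewrite (IH2 _ _ _ _ q rp); apply: (IH1 _ _ _ _ p).
  apply: sort_path rp; exact/(sqcong_path tt).
(* Exactly one side of a square has increasing colors, and [insert_swap] applies to that side. *)
- case=> _ [xy] /= yv rw; move: (sq_neq sqS sq); rewrite -val_eqE neq_ltn /=.
  case/orP=> lt.
    by rewrite (insert_swap cube (esym xy) lt (w := w)) ?(sigmaP sq) //= yv.
  have [sq' lt'] : S (y', x') (x, y) /\ (col y' < col x')%N.
    by rewrite (sq_col sqS sq) (sq_col2 sq); split=> //; apply: (sq_sym sqS).
  rewrite (insert_swap cube (sq_comp2 sq) lt' (w := w)) ?(sigmaP sq') //=.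
  by rewrite (sq_rng sqS sq) yv.
Qed.

(** The color of the head of the result tells whether the inserted edge was exchanged or stayed in
    front, so the same happened on both sides. An exchange is undone by reading its square
    backwards. *)
Lemma insert_inj x y s t u v : col x = col y ->
  is_path (rng x) s u -> is_path (rng y) t v ->
  insert x s = insert y t -> x = y /\ s = t.
Proof.
have nonnil z r : insert z r <> [::] by case: r => //= ? ?; case: ifP.
elim: s x y t => [|x1 s IHs] x y [|y1 t] cxy /=.
- by move=> _ _ [->].
- by move=> _ _; case: ifP => // _ [_ /esym/nonnil].
- by move=> _ _; case: ifP => // _ [_ /nonnil].
case=> xx1 sp [yy1 tp].
case: ifP => [/(sigmaS (esym xx1))[x1' [x' [ex sx]]]|lex];
  case: ifP => [/(sigmaS (esym yy1))[y1' [y' [ey sy]]]|ley].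
- rewrite ex ey /= => -[e1].
  have sp' : is_path (rng x') s u by rewrite (sq_rng sqS sx).
  have tp' : is_path (rng y') t v by rewrite (sq_rng sqS sy).
  have cxy' : col x' = col y' by rewrite (sq_col2 sx) (sq_col2 sy).
  case/(IHs _ _ _ cxy' sp' tp')=> e2 ->.
  move/(sq_sym sqS)/sigmaP: sx; rewrite e1 e2.
  by move/(sq_sym sqS)/sigmaP: sy => -> [-> ->].
- rewrite ex => -[e1 _]; move: (sq_neq sqS sx).
  by rewrite -(sq_col sqS sx) e1 cxy eqxx.
- rewrite ey => -[e1 _]; move: (sq_neq sqS sy).
  by rewrite -(sq_col sqS sy) -e1 cxy eqxx.
- by case=> -> -> ->.
Qed.

Lemma sort_inj u u' v v' s t : is_path u s v -> is_path u' t v' ->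
  map col s = map col t ->
  foldr insert [::] s = foldr insert [::] t -> s = t.
Proof.
elim: s u u' t => [|x s IHs] u u' [|y t] //= [_ sv] [_ tv] [cxy cst] e.
have spx := sort_path sv (erefl : is_path v [::] v).
have spy := sort_path tv (erefl : is_path v' [::] v').
by have [-> /(IHs _ _ _ sv tv cst) ->] := insert_inj cxy spx spy e.
Qed.

End Sorting.

Lemma sqcong_eq (cube : cube_condition) u v s t : is_path u s v ->
  sqcong s t -> map col s = map col t -> s = t.
Proof.
move=> sv st cst.
(* On a pair without a square any value of [sigma] will do; the pair itself is taken. *)
have [|sigma sigmaP] := @choice _ _ (fun p p' => forall q, S p q -> p' = q).
  move=> -[x y]; case: (EM (exists q, S (x, y) q)) => [[[y' x'] sq]|no].
    have [q0 [_ q0P]] := S_complete (sq_comp sqS sq) (sq_neq sqS sq).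
    by exists q0 => q /q0P.
  by exists (x, y) => q sq; case: no; exists q.
apply: (sort_inj sigmaP sv ((sqcong_path st _ _).1 sv) cst).
exact: (sort_sqcong sigmaP cube st sv (erefl : is_path v [::] v)).
Qed.

End Completeness.

(** * Unique factorization in the quotient of the path category *)

Section QuotientGraph.
Context (R : morrel (path_category D)) (cR : congruence R).
Context (d : degree_functor k (path_category D)).
Context (dR : forall a b (f g : @mor (path_category D) a b),
  R f g -> deg d f = deg d g).
Hypothesis degE : forall a b (f : gpath a b) i,
  deg d (f : @mor (path_category D) a b) i = count_mem i (map col (sval f)).
Hypothesis RE : forall a b (f g : gpath a b),
  @R a b f g <-> sqcong (sval f) (sval g).

Definition color_word (n : {ffun 'I_k -> nat}) : seq 'I_k :=
  flatten [seq nseq (n i) i | i <- enum 'I_k].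

Lemma count_color_word n i : count_mem i (color_word n) = n i.
Proof.
rewrite /color_word count_flatten -map_comp sumnE big_map big_enum /=.
rewrite (bigD1 i) //= count_nseq /= eqxx mul1n big1 ?addn0 // => j ji.
by rewrite count_nseq /= (negbTE ji).
Qed.

Lemma deg_color_word a b (f : gpath a b) (n : {ffun 'I_k -> nat}) :
  deg d (f : @mor (path_category D) a b) = n <->
  perm_eq (map col (sval f)) (color_word n).
Proof.
split=> [fn|/allP fn].
  by apply/allP => i _; rewrite /= count_color_word -fn degE.
apply/ffunP => i; rewrite degE -(count_color_word n).
have [|] := boolP (i \in map col (sval f) ++ color_word n).
  by move/fn/eqP.
by rewrite mem_cat negb_or => /andP[/count_memPn -> /count_memPn ->].
Qed.

(** A factorization in degrees [n] and [m] is represented by a path with color word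
    [color_word n ++ color_word m]. The class of [l] contains such a path by rearrangement and only
    one by [sqcong_eq]; cutting it after the first block gives the factors. *)
Lemma quotient_kgraph : complete_squares -> cube_condition ->
  is_kgraph (quotient_degree cR dR).
Proof.
move=> S_complete cube a c l n m; rewrite /= => ln.
have rearr e b (x : @qmor _ _ cR e b) (h : {ffun 'I_k -> nat}) :
    deg d (qrepr x) = h ->
    exists2 s : gpath e b, map col (sval s) = color_word h & qclass cR s = x.
  move=> /deg_color_word /(sqcong_rearrange S_complete (svalP (qrepr x)))[s xs sh].
  have sp := (sqcong_path xs _ _).1 (svalP (qrepr x)).
  exists (to_gpath sp) => //; rewrite -[RHS]qreprK; apply/qclassP/RE.
  exact: sqcong_sym.
have ln' : perm_eq (map col (sval (qrepr l))) (color_word n ++ color_word m).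
  apply: (perm_trans ((deg_color_word _ _).1 ln)).
  apply/allP => i _; rewrite /= count_cat !count_color_word.
  by apply/eqP; rewrite ffunE.
have [s ls sl] := sqcong_rearrange S_complete (svalP (qrepr l)) ln'.
have sp := (sqcong_path ls _ _).1 (svalP (qrepr l)).
move: ls sl; rewrite -(cat_take_drop (size (color_word n)) s).
set s1 := take _ s; set s2 := drop _ s => ls sl.
have s1n : map col s1 = color_word n.
  by rewrite map_take -[s](cat_take_drop (size (color_word n))) sl take_size_cat.
have s2m : map col s2 = color_word m.
  by rewrite map_drop -[s](cat_take_drop (size (color_word n))) sl drop_size_cat.
move: sp; rewrite -(cat_take_drop (size (color_word n)) s).
case/is_path_split; rewrite -/s1 -/s2 => b p1 p2.
have degq e f (t : gpath e f) h : map col (sval t) = color_word h ->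
    deg d (qrepr (qclass cR t)) = h.
  move=> th; rewrite (dR (qrepr_class cR t)); apply/deg_color_word.
  by rewrite th.
exists (existT _ b (qclass cR (to_gpath p1), qclass cR (to_gpath p2))) => /=.
split.
  split; [exact: degq|exact: degq|].
  by rewrite qcompE -[LHS](qreprK l); apply/qclassP/RE.
(* The factors of any other factorization, each rearranged to its block, compose to the same
   path. *)
case=> b' [y x] /= [/rearr[[t1 q1] t1n <-] /rearr[[t2 q2] t2m <-] lxy].
have st : s1 ++ s2 = t1 ++ t2.
  apply: (sqcong_eq S_complete cube (is_path_cat p1 p2)).
    apply: sqcong_trans (sqcong_sym ls) _.
    move: lxy; rewrite qcompE -[l](qreprK l) => /qclassP/RE.
    by rewrite qreprK.
  by rewrite !map_cat s1n s2m t1n t2m.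
have size1 : size s1 = size t1 by rewrite -(size_map col) s1n -t1n size_map.
have e1 : s1 = t1.
  by rewrite -(take_size_cat s2 (erefl (size s1))) st size1 take_size_cat.
have e2 : s2 = t2.
  by rewrite -(drop_size_cat s2 (erefl (size s1))) st size1 drop_size_cat.
move: p1 p2; rewrite {}e1 {}e2 => p1 p2.
(* The middle vertices are identified first, since the types of the factors depend on them. *)
have eb := is_path_end p1 q1; subst b'.
have -> : to_gpath p1 = to_gpath q1 by apply: gpath_inj.
by have -> : to_gpath p2 = to_gpath q2 by apply: gpath_inj.
Qed.

Definition unit_degree (c : 'I_k) : {ffun 'I_k -> nat} := [ffun i => (c == i : nat)].

Lemma deg_unit a b (f : gpath a b) c :
  deg d (f : @mor (path_category D) a b) = unit_degree c <->
  map col (sval f) = [:: c].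
Proof.
split=> [fc|fc].
  apply: perm_small_eq => //.
  by apply/allP => i _; rewrite /= -degE fc ffunE addn0.
by apply/ffunP => i; rewrite degE fc ffunE /= addn0.
Qed.

Lemma deg_unit_class a b (f : gpath a b) c : map col (sval f) = [:: c] ->
  deg d (qrepr (qclass cR f)) = unit_degree c.
Proof. by move=> fc; rewrite (dR (qrepr_class cR f)); apply/deg_unit. Qed.

(** Each side of a square has two edges, so a single edge is alone in its class. *)
Lemma qrepr_edge a b (f : gpath a b) x : sval f = [:: x] ->
  sval (qrepr (qclass cR f)) = [:: x].
Proof.
move=> fx; apply: sqcong_edge; rewrite -fx; apply: sqcong_sym.
by apply/RE/(qrepr_class cR f).
Qed.

(** Factoring the class of [xy] in the degrees of [y] and [x], in this order, yields single edges
    [y'] and [x'] with [xy] congruent to [y'x']. These words have first edges of different colors,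
    so [sqcong_short] gives a square on [(x, y)]. *)
Lemma quotient_complete : is_kgraph (quotient_degree cR dR) -> complete_squares.
Proof.
move=> kg x y xy xNy.
have lp : is_path (src x) [:: x; y] (rng y) by [].
pose l := to_gpath lp.
have [|[b [al be]] [/= [dal dbe lab] uniq]] :=
    kg _ _ (qclass cR l) (unit_degree (col y)) (unit_degree (col x)).
  rewrite /= (dR (qrepr_class cR l)); apply/ffunP => i.
  by rewrite degE !ffunE /= addn0 addrC.
move/deg_unit: dal; move/deg_unit: dbe.
case eal: (sval (qrepr al)) => [|y' [|? ?]] //.
case ebe: (sval (qrepr be)) => [|x' [|? ?]] //=.
case=> cx [cy].
have lxy : sqcong [:: x; y] [:: y'; x'].
  move: lab; rewrite -(qreprK al) -(qreprK be) => /=.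
  rewrite qcompE => /qclassP/RE.
  by rewrite /= eal ebe.
(* Each square on [(x, y)] gives a factorization in the same degrees, so uniqueness determines its
   other side. *)
have sq q : S (x, y) q -> q = (y', x').
  case: q => y1 x1 sq.
  have p1 : is_path (src x) [:: y1] (src x1).
    by split; [exact: (sq_src sqS sq)|exact: (sq_comp2 sq)].
  have p2 : is_path (src x1) [:: x1] (rng y).
    by split; last exact: (sq_rng sqS sq).
  pose f1 := to_gpath p1.
  pose f2 := to_gpath p2.
  (* Passing to the underlying words turns an equality of dependent pairs into equalities of
     edges. *)
  have /(congr1 (fun f : {e : vtx D & (qmor cR e (src x) * qmor cR (rng y) e)%type} =>
      (sval (qrepr (projT2 f).1), sval (qrepr (projT2 f).2)))) :
      existT (fun e => (qmor cR e (src x) * qmor cR (rng y) e)%type) b (al, be)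
      = existT _ (src x1) (qclass cR f1, qclass cR f2).
    apply: uniq.
    split=> /=.
    - by apply: deg_unit_class; rewrite /= (sq_col sqS sq).
    - by apply: deg_unit_class; rewrite /= (sq_col2 sq).
    - by rewrite qcompE; apply/qclassP/RE/sqcong_sq.
  rewrite /= eal ebe.
  rewrite (qrepr_edge (erefl : sval f1 = _)) (qrepr_edge (erefl : sval f2 = _)).
  by move=> [-> ->].
case: (sqcong_short lxy) => // [[e _]|[[x0 [y0 [q [[<- <-] sq0]]]] _]].
  by move: xNy; rewrite e cy eqxx.
by exists q; split=> // q' /sq ->; rewrite (sq _ sq0).
Qed.

End QuotientGraph.
End ColoredSquares.

(** * Unique existence and pullbacks of sets *)

Lemma unique_image_iff (A B : Type) (P : A -> Prop) (F : A -> B) :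
  (forall x y, P x -> P y -> F x = F y -> x = y) ->
  (exists! b, exists2 x, P x & b = F x) <-> (exists! x, P x).
Proof.
move=> inj; split=> [[b [[x Px bx] ub]]|[x [Px ux]]].
  by exists x; split=> // y Py; apply: inj => //; rewrite -bx; apply: ub; exists y.
by exists (F x); split=> [|b [y Py ->]]; [exists x|rewrite (ux y Py)].
Qed.

(** A compatible pair of elements is a compatible pair of maps from a one-point set. Conversely, the
    mediating map is assembled pointwise by choice. *)
Lemma is_pullback_iff (P A B C : Type)
    (a : P -> A) (b : P -> B) (f : A -> C) (g : B -> C) :
  (forall x, f (a x) = g (b x)) ->
  is_pullback a b f g <->
  forall y z, f y = g z -> exists! x, a x = y /\ b x = z.
Proof.
move=> fagb; split=> [[_ pb] y z yz|pb].
  have [|w [[wa wb] uw]] := pb unit (fun=> y) (fun=> z).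
    by apply: funext => -[].
  exists (w tt); split.
    by split; [rewrite -[RHS]/((fun=> y) tt) -wa|rewrite -[RHS]/((fun=> z) tt) -wb].
  move=> x [xy xz]; have -> // : w = fun=> x.
  by apply: uw; split; apply: funext => -[].
split=> [|X u v uv]; first exact: funext.
have /choice[w wP] : forall x, exists y, a y = u x /\ b y = v x.
  move=> x; have [|y [yP _]] := pb (u x) (v x); last by exists y.
  exact: (congr1 (@^~ x) uv).
exists w; split.
  by split; apply: funext => x; have [] := wP x.
move=> w' [wa wb]; apply: funext => x.
have [|y [_ uy]] := pb (u x) (v x); first exact: (congr1 (@^~ x) uv).
rewrite -(uy (w x) (wP x)); apply: uy; split.
  by rewrite -wa.
by rewrite -wb.
Qed.

(** * The squares and cubes of a textile system *)

Section Textile.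
Context (T : textile3).

Definition tindex (x : tedge T) : 'I_3 :=
  match x with
  | EF1 _ => Ordinal (isT : 1 < 3)%N
  | EF2 _ => Ordinal (isT : 0 < 3)%N
  | EE _ => Ordinal (isT : 2 < 3)%N
  end.

(** The relations [R12], [R23], [R13] and their inverses, one clause for each ordered pair of
    distinct colors. Each clause constrains a cell by the side [p] and reads [q] off the cell, the
    shape to which [unique_image_iff] applies. *)
Definition tsquare (p q : tedge T * tedge T) : Prop :=
  match p with
  | (EF2 v, EF1 w) => exists2 x, hom0 q1 x = w /\ hom0 p2 x = v &
      q = (EF1 (hom0 p1 x), EF2 (hom0 q2 x))
  | (EF1 w, EF2 v) => exists2 x, hom0 p1 x = w /\ hom0 q2 x = v &
      q = (EF2 (hom0 p2 x), EF1 (hom0 q1 x))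
  | (EF1 w, EE e) => exists2 x, src x = w /\ hom1 h1 x = e &
      q = (EE (hom1 g1 x), EF1 (rng x))
  | (EE e, EF1 w) => exists2 x, rng x = w /\ hom1 g1 x = e &
      q = (EF1 (src x), EE (hom1 h1 x))
  | (EF2 v, EE e) => exists2 x, src x = v /\ hom1 h2 x = e &
      q = (EE (hom1 g2 x), EF2 (rng x))
  | (EE e, EF2 v) => exists2 x, rng x = v /\ hom1 g2 x = e &
      q = (EF2 (src x), EE (hom1 h2 x))
  | _ => False
  end.

Lemma comm0_gp (x : vtx (G T)) : hom0 g1 (hom0 p1 x) = hom0 g2 (hom0 p2 x).
Proof. exact ((comm_gp T).1 x). Qed.

Lemma comm0_hq (x : vtx (G T)) : hom0 h1 (hom0 q1 x) = hom0 h2 (hom0 q2 x).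
Proof. exact ((comm_hq T).1 x). Qed.

Lemma comm0_gq (x : vtx (G T)) : hom0 g1 (hom0 q1 x) = hom0 h2 (hom0 p2 x).
Proof. exact ((comm_gq T).1 x). Qed.

Lemma comm0_hp (x : vtx (G T)) : hom0 h1 (hom0 p1 x) = hom0 g2 (hom0 q2 x).
Proof. exact ((comm_hp T).1 x). Qed.

Lemma comm1_gp (x : edge (G T)) : hom1 g1 (hom1 p1 x) = hom1 g2 (hom1 p2 x).
Proof. exact ((comm_gp T).2 x). Qed.

Lemma comm1_hq (x : edge (G T)) : hom1 h1 (hom1 q1 x) = hom1 h2 (hom1 q2 x).
Proof. exact ((comm_hq T).2 x). Qed.

Lemma comm1_gq (x : edge (G T)) : hom1 g1 (hom1 q1 x) = hom1 h2 (hom1 p2 x).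
Proof. exact ((comm_gq T).2 x). Qed.

Lemma comm1_hp (x : edge (G T)) : hom1 h1 (hom1 p1 x) = hom1 g2 (hom1 q2 x).
Proof. exact ((comm_hp T).2 x). Qed.

Lemma tsquare_system : square_system (D := tgraph T) tindex tsquare.
Proof.
split.
- move=> [[w|v|e] [w'|v'|e']] q //= [x [<- <-] ->] /=; by exists x.
- move=> [w|v|e] [w'|v'|e'] y x //= [c [<- <-] _];
  by rewrite ?hom_src ?hom_rng ?comm0_hp ?comm0_gq.
- move=> [w|v|e] [w'|v'|e'] y x //= [c [? ?] [-> _]] /=; subst;
  by rewrite ?hom_src ?comm0_gp.
- move=> [w|v|e] [w'|v'|e'] y x //= [c [? ?] [_ ->]] /=; subst;
  by rewrite ?hom_rng ?comm0_hq.
- by move=> [w|v|e] [w'|v'|e'] y x //= [c _ [-> _]].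
- by move=> [w|v|e] [w'|v'|e'].
Qed.

Lemma tdegE (a b : vtx (tgraph T)) (f : gpath a b) i :
  deg (path_degree (@tcolor T)) (f : @mor (path_category (tgraph T)) a b) i
  = count_mem i (map tindex (sval f)).
Proof.
rewrite /=; elim: (sval f) => [|x s IHs]; first by rewrite big_nil ffunE.
rewrite big_cons ffunE IHs /=; congr (_ + _).
by case: x => ?; rewrite ffunE eq_sym.
Qed.

Lemma tcongrE (a b : vtx (tgraph T)) (f g : gpath a b) :
  @tcongr T a b f g <-> sqcong (D := tgraph T) tsquare (sval f) (sval g).
Proof.
split.
  (* Congruence of the underlying words is a congruence containing the generators, so minimality
     applies. *)
  pose S a b (f g : @mor (path_category (tgraph T)) a b) :=
    sqcong (D := tgraph T) tsquare (sval f) (sval g).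
  move=> /(_ S); apply.
    split=> [*|a' b' ? ? |a' b' ? ? ?|a' b' c' ? ? ? ?].
    - exact: sqcong_refl.
    - exact: sqcong_sym.
    - exact: sqcong_trans.
    - exact: sqcong_cat.
  move=> a' b' f' g' [] [x]; rewrite /S.
  - move=> [v [w [w' [-> -> [c [<- <- <- <-]]]]]].
    by apply: sqcong_sq => /=; exists c.
  - move=> [v [w [w' [-> -> [c [<- <- <- <-]]]]]].
    by apply: sqcong_sq => /=; exists c.
  - move=> [v [w [w' [-> -> [c [<- <- <- <-]]]]]].
    by apply: sqcong_sq => /=; exists c.
  - by move=> [-> ->]; apply: sqcong_refl.
have cT := smallest_congruence_cong (@Rgen T).
move: {2 3}(sval f) (erefl (sval f)) {2 3}(sval g) (erefl (sval g)) => s fs t gt st.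
elim: st a b f g fs gt => {s t}
  [s|s t st IH|t s r st IH1 tr IH2|s s' t t' ss IH1 tt IH2|x y y' x' sq] a b f g fs gt.
- by rewrite (gpath_inj (etrans fs (esym gt))); apply: (cong_refl cT).
- by apply: (cong_sym cT); apply: IH.
(* The intermediate word is a path with the same end points, hence a morphism. *)
- have tp : is_path b t a.
    by rewrite -(sqcong_path tsquare_system st) -fs; apply: (svalP f).
  apply: (cong_trans cT (g := to_gpath tp)); [exact: IH1|exact: IH2].
- have := svalP f; have := svalP g; rewrite fs gt.
  case/is_path_split=> c' g1 g2 /is_path_split[c f1 f2].
  have c1 := (sqcong_path tsquare_system ss _ _).1 f1.
  have ecc := is_path_end c1 g1; subst c'.
  rewrite (_ : f = gpath_comp (to_gpath f1) (to_gpath f2)); last exact: gpath_inj.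
  rewrite (_ : g = gpath_comp (to_gpath g1) (to_gpath g2)); last exact: gpath_inj.
  by apply: (cong_comp cT); [exact: IH1|exact: IH2].
- have gen : forall a b (f g : gpath a b), Rgen f g -> @tcongr T a b f g.
    by move=> ? ? ? ? fg S cS RS; exact: RS.
  move: x y fs sq => [w|v|e] [w'|v'|e'] fs //= [c [cw cv] [ey ex]]; subst.
  + apply: (cong_sym cT); apply: gen; apply: Or41.
    by do 4 eexists; split; [exact: gt|exact: fs|exists c].
  + apply: gen; apply: Or42.
    by do 4 eexists; split; [exact: fs|exact: gt|exists c].
  + apply: gen; apply: Or41.
    by do 4 eexists; split; [exact: fs|exact: gt|exists c].
  + apply: gen; apply: Or43.
    by do 4 eexists; split; [exact: fs|exact: gt|exists c].
  + apply: (cong_sym cT); apply: gen; apply: Or42.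
    by do 4 eexists; split; [exact: gt|exact: fs|exists c].
  + apply: (cong_sym cT); apply: gen; apply: Or43.
    by do 4 eexists; split; [exact: gt|exact: fs|exists c].
Qed.

(** The edge [y] of [G] obtained by lifting is the cube: its six faces are its source, its range and
    its images under [p1], [q1], [p2], [q2]. *)
Lemma tcube : s_path_lifting (@q1 T) ->
  complete_squares (D := tgraph T) tindex tsquare ->
  cube_condition (D := tgraph T) tindex tsquare.
Proof.
move=> lift compl [w|v|e] [w'|v'|e'] [w''|v''|e''] //= xy yz _ _.
(* Increasing colors leave only the order [EF2], [EF1], [EE]. The squares on the first two and on
   the last two edges are a vertex [c] of [G] and an edge [f] of [F1] that share [w'], so [f] lifts
   along [q1] to an edge starting at [c]. *)
have [q [[c [cw cv] _] _]] := compl (EF2 v) (EF1 w') xy isT.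
have [q' [[f [fw fe] _] _]] := compl (EF1 w') (EE e'') yz isT.
have [|y [yc yf]] := lift c f; first by rewrite cw.
subst c f w' v e''.
exists (EF2 (hom0 q2 (src y))), (EF2 (rng (hom1 p2 y))), (EF2 (rng (hom1 q2 y))).
exists (EF1 (hom0 p1 (src y))), (EF1 (rng (hom1 q1 y))), (EF1 (rng (hom1 p1 y))).
exists (EE (hom1 g2 (hom1 q2 y))), (EE (hom1 g1 (hom1 q1 y))), (EE (hom1 g1 (hom1 p1 y))).
split; split.
- by exists (src y).
- by exists (hom1 q2 y); rewrite // hom_src comm1_hq.
- by exists (hom1 p1 y); rewrite // hom_src comm1_hp.
- by exists (hom1 q1 y); rewrite ?hom_src.
- by exists (hom1 p2 y); rewrite ?hom_src ?comm1_gq ?comm1_gp.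
- by exists (rng y); rewrite ?hom_rng.
Qed.

(** The six ordered pairs of distinct colors match the six conditions: two liftings for [g1], [g2],
    two for [h1], [h2], and two pullbacks. A cell is determined by its four sides, so a unique
    opposite side amounts to a unique cell. *)
Lemma complete_tsquare_iff :
  complete_squares (D := tgraph T) tindex tsquare <->
  [/\ unique_r_path_lifting (@g1 T) /\ unique_r_path_lifting (@g2 T),
      unique_s_path_lifting (@h1 T) /\ unique_s_path_lifting (@h2 T)
    & is_pullback (hom0 (@q1 T)) (hom0 (@p2 T)) (hom0 (@g1 T)) (hom0 (@h2 T)) /\
      is_pullback (hom0 (@p1 T)) (hom0 (@q2 T)) (hom0 (@h1 T)) (hom0 (@g2 T))].
Proof.
have sqF12 v w : (exists! q, tsquare (EF2 v, EF1 w) q) <->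
    (exists! x, hom0 q1 x = w /\ hom0 p2 x = v).
  apply: unique_image_iff => x y [xw xv] [yw yv] [e1 e2].
  by apply: inj_G0; rewrite xw xv yw yv e1 e2.
have sqF21 w v : (exists! q, tsquare (EF1 w, EF2 v) q) <->
    (exists! x, hom0 p1 x = w /\ hom0 q2 x = v).
  apply: unique_image_iff => x y [xw xv] [yw yv] [e1 e2].
  by apply: inj_G0; rewrite xw xv yw yv e1 e2.
have sqF1E w e : (exists! q, tsquare (EF1 w, EE e) q) <->
    (exists! x, src x = w /\ hom1 h1 x = e).
  apply: unique_image_iff => x y [xw xv] [yw yv] [e1 e2].
  by apply: inj_F1; rewrite xw xv yw yv e1 e2.
have sqEF1 e w : (exists! q, tsquare (EE e, EF1 w) q) <->
    (exists! x, rng x = w /\ hom1 g1 x = e).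
  apply: unique_image_iff => x y [xw xv] [yw yv] [e1 e2].
  by apply: inj_F1; rewrite xw xv yw yv e1 e2.
have sqF2E v e : (exists! q, tsquare (EF2 v, EE e) q) <->
    (exists! x, src x = v /\ hom1 h2 x = e).
  apply: unique_image_iff => x y [xw xv] [yw yv] [e1 e2].
  by apply: inj_F2; rewrite xw xv yw yv e1 e2.
have sqEF2 e v : (exists! q, tsquare (EE e, EF2 v) q) <->
    (exists! x, rng x = v /\ hom1 g2 x = e).
  apply: unique_image_iff => x y [xw xv] [yw yv] [e1 e2].
  by apply: inj_F2; rewrite xw xv yw yv e1 e2.
have pbq := is_pullback_iff comm0_gq; have pbp := is_pullback_iff comm0_hp.
split.
  move=> compl; split; split.
  - by move=> w e we; apply/sqEF1; apply: (compl (EE e) (EF1 w)).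
  - by move=> v e ve; apply/sqEF2; apply: (compl (EE e) (EF2 v)).
  - by move=> w e we; apply/sqF1E; apply: (compl (EF1 w) (EE e)).
  - by move=> v e ve; apply/sqF2E; apply: (compl (EF2 v) (EE e)).
  - by apply/pbq => w v wv; apply/sqF12; apply: (compl (EF2 v) (EF1 w)).
  - by apply/pbp => w v wv; apply/sqF21; apply: (compl (EF1 w) (EF2 v)).
move=> [[ug1 ug2] [uh1 uh2] [/pbq pb1 /pbp pb2]] [w|v|e] [w'|v'|e'] //= xy _.
- exact/sqF21/pb2.
- exact/sqF1E/uh1.
- exact/sqF12/pb1.
- exact/sqF2E/uh2.
- exact/sqEF1/ug1.
- exact/sqEF2/ug2.
Qed.

End Textile.

Theorem theorem7p5 (T : textile3) (q1_lifts : s_path_lifting (@q1 T)) :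
  is_kgraph (Lambda_degree T) <->
  [/\ unique_r_path_lifting (@g1 T) /\ unique_r_path_lifting (@g2 T),
      unique_s_path_lifting (@h1 T) /\ unique_s_path_lifting (@h2 T)
    & is_pullback (hom0 (@q1 T)) (hom0 (@p2 T)) (hom0 (@g1 T)) (hom0 (@h2 T)) /\
      is_pullback (hom0 (@p1 T)) (hom0 (@q2 T)) (hom0 (@h1 T)) (hom0 (@g2 T))].
Proof.
rewrite -complete_tsquare_iff; split=> [kg|compl].
  exact: (quotient_complete (tsquare_system T) (@tdegE T) (@tcongrE T) kg).
apply: (quotient_kgraph (tsquare_system T) (@tdegE T) (@tcongrE T) compl).
exact: tcube.
Qed.
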